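(* Let $(p_1,q_1,r_1)$ and $(p_2,q_2,r_2)$ be triples of pairwise relatively prime integers with $1<p_i<q_i<r_i$ for $i=1,2$. Suppose $(p_1,q_1,r_1)\ge(p_2,q_2,r_2)$, i.e. $p_1\ge p_2$, $q_1\ge q_2$ and $r_1\ge r_2$. Then $\kappa(p_1,q_1,r_1)\ge\kappa(p_2,q_2,r_2)$.
   Context: For pairwise relatively prime integers $1<p<q<r$, let $(e_0,p',q',r')$ be the unique integers with $e_0pqr+p'qr+pq'r+pqr'=-1$, $1\le p'\le p-1$, $1\le q'\le q-1$, $1\le r'\le r-1$. Define $$\Delta(n)=1+|e_0|n-\left\lceil\frac{np'}{p}\right\rceil-\left\lceil\frac{nq'}{q}\right\rceil-\left\lceil\frac{nr'}{r}\right\rceil\quad(n\in\mathbb{Z}_{\ge0}),\qquad \kappa(p,q,r)=\left|\sum_{n=0}^\infty\min\{0,\Delta(n)\}\right| .$$ *)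

(* Defs.v *)
From mathcomp Require Import all_boot all_order all_algebra.
From mathcomp Require Import boolp classical_sets cardinality fsbigop.
From mathcomp Require Import zify ring lra.

Set Implicit Arguments.
Unset Strict Implicit.
Unset Printing Implicit Defensive.

Import Order.TTheory GRing.Theory Num.Theory.
Local Open Scope classical_set_scope.
Local Open Scope ring_scope.

Definition coprime_triple (p q r : int) : Prop :=
  [/\ 1 < p, p < q, q < r & [/\ coprimez p q, coprimez p r & coprimez q r]].

Definition is_seifert (p q r : int) (s : int * int * int * int) : Prop :=
  let: (e0, p', q', r') := s in
  [/\ e0 * p * q * r + p' * q * r + p * q' * r + p * q * r' = -1,
      1 <= p' <= p - 1, 1 <= q' <= q - 1 & 1 <= r' <= r - 1].

(* The default value is never used when [coprime_triple p q r] holds, see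
   [seifertP] and [seifert_unique] below. *)
Definition seifert (p q r : int) : int * int * int * int :=
  xget (0, 0, 0, 0) (is_seifert p q r).

Definition Delta (p q r : int) (n : nat) : int :=
  let: (e0, p', q', r') := seifert p q r in
  1 + `|e0| * n%:Z
    - Num.ceil ((n%:Z * p')%:~R / p%:~R : rat)
    - Num.ceil ((n%:Z * q')%:~R / q%:~R : rat)
    - Num.ceil ((n%:Z * r')%:~R / r%:~R : rat).

(* The terms vanish for large n, so the infinite series is the finitely
   supported sum over all of nat, see [Delta_ge0] and [kappa_partial_sum]. *)
Definition kappa (p q r : int) : int :=
  `|\sum_(n \in [set: nat]) Num.min 0 (Delta p q r n)|.

Lemma coprimez_inv (m a : int) : 1 < m -> coprimez m a ->
  exists2 x : int, 1 <= x <= m - 1 & (m %| x * a + 1)%Z.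
Proof.
move=> m1 /coprimezP [[u v] /= uv].
exists ((- v) %% m)%Z; last first.
  apply/dvdzP; exists (u - ((- v) %/ m)%Z * a).
  have := divz_eq (- v) m; move: ((- v) %/ m)%Z ((- v) %% m)%Z => k x kx.
  have -> : x = - v - k * m by rewrite kx; ring.
  by rewrite -uv; ring.
have m0 : m != 0 by lia.
have := modz_ge0 (- v) m0; have := @ltz_pmod (- v) m ltac:(lia).
have := divz_eq (- v) m; move: ((- v) %/ m)%Z ((- v) %% m)%Z => k x kx xm x0.
suff : x != 0 by lia.
apply/eqP => x00; move: kx; rewrite x00 addr0 => kx.
have : (m %| 1)%Z.
  apply/dvdzP; exists (u - k * a); transitivity (u * m + v * a).
    by rewrite uv.
  have -> : v = - (k * m) by lia.
  by ring.
by rewrite dvdz1; lia.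
Qed.

Lemma coprimez_inv_unique (m a x y : int) :
  1 <= x <= m - 1 -> 1 <= y <= m - 1 -> coprimez m a ->
  (m %| x * a + 1)%Z -> (m %| y * a + 1)%Z -> x = y.
Proof.
move=> hx hy ma dx dy.
have : (m %| (x - y) * a)%Z.
  have -> : (x - y) * a = (x * a + 1) - (y * a + 1) by ring.
  by rewrite rpredB.
rewrite Gauss_dvdzl // -eqz_mod_dvd !modz_small; [by move/eqP| |]; lia.
Qed.

Lemma is_seifert_dvd p q r e0 p' q' r' : is_seifert p q r (e0, p', q', r') ->
  [/\ (p %| p' * (q * r) + 1)%Z, (q %| q' * (p * r) + 1)%Z
    & (r %| r' * (p * q) + 1)%Z].
Proof.
move=> [E _ _ _]; split; apply/dvdzP.
- exists (- (e0 * q * r + q' * r + q * r')).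
  by rewrite -[1]opprK -E; ring.
- exists (- (e0 * p * r + p' * r + p * r')).
  by rewrite -[1]opprK -E; ring.
- exists (- (e0 * p * q + p' * q + p * q')).
  by rewrite -[1]opprK -E; ring.
Qed.

Lemma seifert_exists p q r : coprime_triple p q r ->
  exists s, is_seifert p q r s.
Proof.
move=> [p1 pq qr [cpq cpr cqr]].
have [p' hp' dp] := @coprimez_inv p (q * r) p1
  ltac:(by rewrite coprimezMr cpq cpr).
have [q' hq' dq] := @coprimez_inv q (p * r) ltac:(lia)
  ltac:(by rewrite coprimezMr coprimez_sym cpq cqr).
have [r' hr' dr] := @coprimez_inv r (p * q) ltac:(lia)
  ltac:(by rewrite coprimezMr coprimez_sym cpr coprimez_sym cqr).
pose T := p' * q * r + p * q' * r + p * q * r' + 1.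
have : (p * q * r %| T)%Z.
  rewrite !Gauss_dvdz ?coprimezMl ?cpr ?cqr // -andbA; apply/and3P; split.
  - have -> : T = (p' * (q * r) + 1) + p * (q' * r + q * r') by rewrite /T; ring.
    by rewrite rpredD // dvdz_mulr.
  - have -> : T = (q' * (p * r) + 1) + q * (p' * r + p * r') by rewrite /T; ring.
    by rewrite rpredD // dvdz_mulr.
  - have -> : T = (r' * (p * q) + 1) + r * (p' * q + p * q') by rewrite /T; ring.
    by rewrite rpredD // dvdz_mulr.
move=> /dvdzP [k kT]; exists (- k, p', q', r'); split=> //.
have -> : - k * p * q * r = - T by rewrite kT; ring.
by rewrite /T; ring.
Qed.

Lemma seifertP p q r : coprime_triple p q r ->
  is_seifert p q r (seifert p q r).
Proof. by move=> /seifert_exists; apply: xgetPex. Qed.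

Lemma seifert_unique p q r s : coprime_triple p q r ->
  is_seifert p q r s -> s = seifert p q r.
Proof.
move=> H; move: (H) (seifertP H) => [p1 pq qr [cpq cpr cqr]].
case: s (seifert p q r) => [[[e p'] q'] r'] [[[f p2] q2] r2] S2 S1.
have [dp dq dr] := is_seifert_dvd S1; have [dp2 dq2 dr2] := is_seifert_dvd S2.
case: S1 S2 => [E1 hp hq hr] [E2 hp2 hq2 hr2].
have ep : p' = p2.
  apply: coprimez_inv_unique hp hp2 _ dp dp2.
  by rewrite coprimezMr cpq cpr.
have eq : q' = q2.
  apply: coprimez_inv_unique hq hq2 _ dq dq2.
  by rewrite coprimezMr coprimez_sym cpq cqr.
have er : r' = r2.
  apply: coprimez_inv_unique hr hr2 _ dr dr2.
  by rewrite coprimezMr coprimez_sym cpr coprimez_sym cqr.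
subst p2 q2 r2; congr (_, _, _, _).
have pqr0 : p * q * r != 0 by rewrite !mulf_neq0 //; lia.
apply: (mulIf pqr0); rewrite !mulrA.
by move: (E1); rewrite -E2 => /addIr/addIr/addIr.
Qed.

Lemma Delta_ge0 p q r n : coprime_triple p q r ->
  2 * p * q * r <= n%:Z -> 0 <= Delta p q r n.
Proof.
move=> H hn; rewrite /Delta; move: (seifertP H) (H).
case: (seifert p q r) => [[[e p'] q'] r'] [E hp hq hr] [p1 pq qr _].
have e0 : e <= 0.
  rewrite leNgt; apply/negP => e0.
  have : 0 < e * p * q * r by rewrite !mulr_gt0 //; lia.
  have : 0 < p' * q * r by rewrite !mulr_gt0 //; lia.
  have : 0 < p * q' * r by rewrite !mulr_gt0 //; lia.
  have : 0 < p * q * r' by rewrite !mulr_gt0 //; lia.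
  lia.
rewrite ler0_norm //.
set a := Num.ceil _; set b := Num.ceil _; set c := Num.ceil _.
have ha : (a - 1)%:~R < (n%:Z * p')%:~R / p%:~R :> rat by exact: ceilB1_lt.
have hb : (b - 1)%:~R < (n%:Z * q')%:~R / q%:~R :> rat by exact: ceilB1_lt.
have hc : (c - 1)%:~R < (n%:Z * r')%:~R / r%:~R :> rat by exact: ceilB1_lt.
have ga : (a - 1) * p < n%:Z * p'.
  by rewrite -(ltr_int rat) intrM -ltr_pdivlMr // ltr0z; lia.
have gb : (b - 1) * q < n%:Z * q'.
  by rewrite -(ltr_int rat) intrM -ltr_pdivlMr // ltr0z; lia.
have gc : (c - 1) * r < n%:Z * r'.
  by rewrite -(ltr_int rat) intrM -ltr_pdivlMr // ltr0z; lia.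
have pqr0 : 0 < p * q * r by rewrite !mulr_gt0 //; lia.
suff : -1 < 1 + - e * n%:Z - a - b - c by lia.
rewrite -(ltr_pM2r pqr0).
have qr0 : 0 < q * r by rewrite mulr_gt0 //; lia.
have pr0 : 0 < p * r by rewrite mulr_gt0 //; lia.
have pq0 : 0 < p * q by rewrite mulr_gt0 //; lia.
have ga' : (a - 1) * p * (q * r) < n%:Z * p' * (q * r) by rewrite ltr_pM2r.
have gb' : (b - 1) * q * (p * r) < n%:Z * q' * (p * r) by rewrite ltr_pM2r.
have gc' : (c - 1) * r * (p * q) < n%:Z * r' * (p * q) by rewrite ltr_pM2r.
have En : n%:Z * (e * p * q * r + p' * q * r + p * q' * r + p * q * r')
  = - n%:Z by rewrite E mulrN1.
move: (n%:Z) a b c hn ga' gb' gc' En pqr0 {ha hb hc ga gb gc} => m a b c *.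
lra.
Qed.

Lemma kappa_partial_sum p q r (N : nat) : coprime_triple p q r ->
  2 * p * q * r <= N%:Z ->
  kappa p q r = `|\sum_(0 <= n < N) Num.min 0 (Delta p q r n)|.
Proof.
move=> H hN; rewrite /kappa; congr `|_|.
rewrite -(fsbig_widen `I_N setT) //; last first.
  move=> n /= [_ /negP]; rewrite -leqNgt => Nn.
  by rewrite min_l // Delta_ge0 //; lia.
by rewrite -fsbig_ord big_mkord.
Qed.

(* Main.v *)
Require Import Defs.
From mathcomp Require Import all_boot all_order all_algebra.
From mathcomp Require Import zify ring lra.
Import Order.TTheory GRing.Theory Num.Theory.
Local Open Scope ring_scope.

(** For every [n] there are unique residues [0 <= a < p], [0 <= b < q],
    [0 <= c < r] with [n = a q r + b p r + c p q + (Delta n - 1) p q r].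
    Hence [Delta n >= -1], and substituting [a -> p - a], [b -> q - b],
    [c -> r - c] shows that [Delta n = -1] exactly when
    [n = p q r - a q r - b p r - c p q] for some positive [a], [b], [c].  So
    [kappa p q r] is the number of positive lattice points in the tetrahedron
    [a / p + b / q + c / r <= 1], which grows with [p], [q] and [r]. *)

Lemma ceil_divz (x a m p : int) :
  0 <= a < p -> x + a = m * p -> Num.ceil (x%:~R / p%:~R : rat) = m.
Proof.
move=> /andP[a0 ap] xa; have p0 : (0 : rat) < p%:~R by rewrite ltr0z; lia.
apply: ceil_def; rewrite ltr_pdivlMr // ler_pdivrMr // -!intrM ltr_int ler_int.
by apply/andP; split; [rewrite mulrBl|]; lia.
Qed.

Lemma ceil_divz_residue (x p : int) : 0 < p ->
  exists2 a : int, 0 <= a < p & x + a = Num.ceil (x%:~R / p%:~R : rat) * p.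
Proof.
move=> p0; have pn0 : p != 0 by lia.
have hm : 0 <= ((- x) %% p)%Z < p by rewrite modz_ge0 ?ltz_pmod.
exists ((- x) %% p)%Z => //; have e := divz_eq (- x) p.
have -> : Num.ceil (x%:~R / p%:~R : rat) = - ((- x) %/ p)%Z.
  by apply: (@ceil_divz _ ((- x) %% p)%Z) => //; lia.
lia.
Qed.

(** A positive [e] would make all four terms of the Seifert equation positive, though they sum to
    -1. This settles the absolute value in [Delta]. *)
Lemma seifert_e0_le0 p q r e p' q' r' : coprime_triple p q r ->
  is_seifert p q r (e, p', q', r') -> e <= 0.
Proof.
move=> [p1 pq qr _] [E hp hq hr]; rewrite leNgt; apply/negP => e0.
have : 0 < e * p * q * r by rewrite !mulr_gt0 //; lia.
have : 0 < p' * q * r by rewrite !mulr_gt0 //; lia.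
have : 0 < p * q' * r by rewrite !mulr_gt0 //; lia.
have : 0 < p * q * r' by rewrite !mulr_gt0 //; lia.
lia.
Qed.

(** The residues are the gaps left by rounding up, such as a = p ceil(n p' / p) - n p'. Substituting
    them leaves -n times the Seifert equation. *)
Lemma Delta_residues p q r (n : nat) : coprime_triple p q r ->
  exists a b c : int, [/\ 0 <= a < p, 0 <= b < q, 0 <= c < r &
    n%:Z = a * q * r + p * b * r + p * q * c + (Delta p q r n - 1) * p * q * r].
Proof.
move=> H; rewrite /Delta; have := seifertP H.
case: (seifert p q r) => [[[e p'] q'] r'] S.
have e0 := seifert_e0_le0 _ _ _ _ _ _ _ H S; case: S H => [E _ _ _] [p1 pq qr _].
have [a ha ea] := @ceil_divz_residue (n%:Z * p') p ltac:(lia).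
have [b hb eb] := @ceil_divz_residue (n%:Z * q') q ltac:(lia).
have [c hc ec] := @ceil_divz_residue (n%:Z * r') r ltac:(lia).
exists a, b, c; split=> //; rewrite ler0_norm //.
move: ea eb ec; set u := Num.ceil _; set v := Num.ceil _; set w := Num.ceil _.
move: u v w => u v w ea eb ec.
have -> : a = u * p - n%:Z * p' by rewrite -ea; ring.
have -> : b = v * q - n%:Z * q' by rewrite -eb; ring.
have -> : c = w * r - n%:Z * r' by rewrite -ec; ring.
transitivity (- n%:Z * (e * p * q * r + p' * q * r + p * q' * r + p * q * r')).
  by rewrite E; ring.
by ring.
Qed.

(** Modulo p only x q r survives, and q r is invertible there; likewise for q and r. Applied to
    differences, this makes representations unique. *)
Lemma coprime_triple_dvd p q r x y z k : coprime_triple p q r ->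
  x * q * r + p * y * r + p * q * z = k * p * q * r ->
  [/\ (p %| x)%Z, (q %| y)%Z & (r %| z)%Z].
Proof.
move=> [_ _ _ [cpq cpr cqr]] e; split.
- rewrite -(@Gauss_dvdzl _ _ (q * r)) ?coprimezMr ?cpq //.
  apply/dvdzP; exists (k * q * r - y * r - q * z).
  by apply: (addIr (p * y * r + p * q * z)); rewrite mulrA addrA e; ring.
- rewrite -(@Gauss_dvdzl _ _ (p * r)) ?coprimezMr 1?coprimez_sym ?cpq //.
  apply/dvdzP; exists (k * p * r - x * r - p * z).
  by apply: (addIr (x * q * r + p * q * z)); transitivity (k * p * q * r);
    [rewrite -e|]; ring.
- rewrite -(@Gauss_dvdzl _ _ (p * q)) ?coprimezMr 1?coprimez_sym ?cpr 1?coprimez_sym //.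
  apply/dvdzP; exists (k * p * q - x * q - p * y).
  by apply: (addIr (x * q * r + p * y * r)); transitivity (k * p * q * r);
    [rewrite -e|]; ring.
Qed.

Lemma dvdz_small_eq (m x y : int) :
  (m %| x - y)%Z -> 0 < x -> x <= m -> 0 < y -> y <= m -> x = y.
Proof.
move=> /dvdzP[k e] x0 xm y0 ym; suff : k = 0 by nia.
have : k < 1 by nia.
have : -1 < k by nia.
lia.
Qed.

(** For positive p, q, r this is a / p + b / q + c / r <= 1 with denominators cleared. *)
Definition below_face (p q r a b c : int) : bool :=
  a * q * r + p * b * r + p * q * c <= p * q * r.

Lemma below_face_le p q r a b c : coprime_triple p q r ->
  0 < a -> 0 < b -> 0 < c -> below_face p q r a b c ->
  [/\ a <= p, b <= q & c <= r].
Proof.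
rewrite /below_face => -[p1 pq qr _] a0 b0 c0 h.
have q0 : 0 < q by lia. have r0 : 0 < r by lia. have p0 : 0 < p by lia.
have A : 0 < a * q * r by rewrite !mulr_gt0.
have B : 0 < p * b * r by rewrite !mulr_gt0.
have C : 0 < p * q * c by rewrite !mulr_gt0.
split.
- by rewrite -(ler_pM2r q0) -(ler_pM2r r0); lia.
- by rewrite -(ler_pM2l p0) -(ler_pM2r r0); lia.
- by rewrite -(@ler_pM2l _ (p * q)) ?mulr_gt0 //; lia.
Qed.

Lemma below_face_mono p q r P Q R a b c :
  0 < p <= P -> 0 < q <= Q -> 0 < r <= R -> 0 <= a -> 0 <= b -> 0 <= c ->
  below_face p q r a b c -> below_face P Q R a b c.
Proof.
rewrite /below_face => /andP[p0 pP] /andP[q0 qQ] /andP[r0 rR] a0 b0 c0 h.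
have P0 : 0 < P by lia. have Q0 : 0 < Q by lia. have R0 : 0 < R by lia.
have pqr0 : 0 < p * q * r by rewrite !mulr_gt0.
rewrite -(ler_pM2l pqr0).
(* Over the common denominator p q r P Q R, the fractions a / p, b / q, c / r can only shrink as
   their denominators grow. *)
apply: (@le_trans _ _ ((a * q * r + p * b * r + p * q * c) * (P * Q * R)));
  last by rewrite ler_pM2r ?mulr_gt0.
have A : p * (a * q * r * Q * R) <= P * (a * q * r * Q * R).
  by rewrite ler_wpM2r // !mulr_ge0 // ltW.
have B : q * (b * p * r * P * R) <= Q * (b * p * r * P * R).
  by rewrite ler_wpM2r // !mulr_ge0 // ltW.
have C : r * (c * p * q * P * Q) <= R * (c * p * q * P * Q).
  by rewrite ler_wpM2r // !mulr_ge0 // ltW.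
lra.
Qed.

(** The three residue terms sum to less than 3 p q r, so 0 <= n < ([Delta] + 2) p q r. *)
Lemma Delta_geN1 p q r (n : nat) : coprime_triple p q r -> -1 <= Delta p q r n.
Proof.
move=> H; have [a [b [c [ha hb hc e]]]] := Delta_residues _ _ _ n H.
have [p1 pq qr _] := H.
have q0 : 0 < q by lia. have r0 : 0 < r by lia. have p0 : 0 < p by lia.
have A : 0 < (p - a) * q * r by rewrite !mulr_gt0 //; lia.
have B : 0 < p * (q - b) * r by rewrite !mulr_gt0 //; lia.
have C : 0 < p * q * (r - c) by rewrite !mulr_gt0 //; lia.
have pqr0 : 0 < p * q * r by rewrite !mulr_gt0.
suff : -2 < Delta p q r n by lia.
rewrite -(ltr_pM2r pqr0); have := ler0n int n.
move: (Delta p q r n) (n%:R : int) e => D m; lia.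
Qed.

(** This is p q r (1 - a / p - b / q - c / r), a scaled distance to the slanted face. *)
Definition face_depth (p q r a b c : int) : int :=
  p * q * r - (a * q * r + p * b * r + p * q * c).

Lemma Delta_lt0 p q r (n : nat) : coprime_triple p q r ->
  Delta p q r n < 0 <->
  exists a b c : int, [/\ 0 < a, 0 < b, 0 < c & n%:Z = face_depth p q r a b c].
Proof.
move=> H; have [p1 pq qr _] := H; rewrite /face_depth.
have [a [b [c [ha hb hc e]]]] := Delta_residues _ _ _ n H.
have pqr0 : 0 < p * q * r by rewrite !mulr_gt0 //; lia.
split=> [D0|[x [y [z [x0 y0 z0 e']]]]].
  have D1 : Delta p q r n = -1 by have := Delta_geN1 _ _ _ n H; lia.
  exists (p - a), (q - b), (r - c); split; [lia..|].
  by rewrite e D1; ring.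
have [xp yq zr] : [/\ x <= p, y <= q & z <= r].
  by apply: below_face_le H _ _ _ _ => //; rewrite /below_face; lia.
(* The two expressions for n agree modulo p q r, so x and p - a are congruent modulo p; both lie
   between 1 and p. *)
have [dx dy dz] : [/\ (p %| x - (p - a))%Z, (q %| y - (q - b))%Z
                    & (r %| z - (r - c))%Z].
  apply: (@coprime_triple_dvd _ _ _ _ _ _ (- (Delta p q r n + 1)) H).
  by move: e; rewrite e'; lia.
have ex : x = p - a by apply: dvdz_small_eq dx _ _ _ _; lia.
have ey : y = q - b by apply: dvdz_small_eq dy _ _ _ _; lia.
have ez : z = r - c by apply: dvdz_small_eq dz _ _ _ _; lia.
suff : Delta p q r n = -1 by lia.
apply: (@mulIf _ (p * q * r)); first by lia.
by move: e; rewrite e' ex ey ez; lia.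
Qed.

(** Ordinals start at 0, hence the shift to positive coordinates. The side M is kept separate from
    p, q, r so that two triples can share one finite type. *)
Definition tetrahedron (M : nat) (p q r : int) : {set 'I_M * 'I_M * 'I_M} :=
  [set u : 'I_M * 'I_M * 'I_M |
    below_face p q r u.1.1.+1 u.1.2.+1 u.2.+1].

(** The negative values of [Delta] are all -1, so [kappa] counts the n where they occur, and
    [face_depth] maps the tetrahedron bijectively onto these n. *)
Lemma kappa_card (M : nat) p q r : coprime_triple p q r -> r <= M%:Z ->
  kappa p q r = #|tetrahedron M p q r|%:Z.
Proof.
move=> H rM; have [p1 pq qr _] := H.
have pqr0 : 0 < p * q * r by rewrite !mulr_gt0 //; lia.
(* From N on [Delta] is nonnegative, and no depth of a point exceeds N. *)
pose N := absz (2 * p * q * r).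
have fd0 (a b c : nat) : face_depth p q r a b c <= N%:Z.
  have : 0 <= a%:Z * q * r by rewrite !mulr_ge0 //; lia.
  have : 0 <= p * b%:Z * r by rewrite !mulr_ge0 //; lia.
  have : 0 <= p * q * c%:Z by rewrite !mulr_ge0 //; lia.
  by rewrite /face_depth /N; lia.
rewrite (@kappa_partial_sum _ _ _ N.+1 H); last by rewrite /N; lia.
rewrite big_mkord; pose A := [set n : 'I_N.+1 | Delta p q r n < 0].
have -> : \sum_(n < N.+1) Num.min 0 (Delta p q r n) = - #|A|%:Z.
  rewrite (eq_bigr (fun n : 'I_N.+1 => if Delta p q r n < 0 then -1 else 0)).
    by rewrite -big_mkcond sumr_const mulNrn natz cardsE.
  by move=> n _; have := Delta_geN1 _ _ _ n H; case: ltP; lia.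
rewrite normrN ger0_norm //; congr Posz.
pose d (u : 'I_M * 'I_M * 'I_M) := face_depth p q r u.1.1.+1 u.1.2.+1 u.2.+1.
pose g u : 'I_N.+1 := inord `|d u|%N.
have dE u : u \in tetrahedron M p q r -> d u = (g u)%:Z.
  rewrite inE /below_face => h; have d0 : 0 <= d u by rewrite /d /face_depth; lia.
  have dN : d u <= N%:Z by exact: fd0.
  by rewrite /g inordK; lia.
suff -> : A = g @: tetrahedron M p q r.
  apply: card_in_imset => -[[a b] c] [[x y] z] ha hx gE.
  have := dE _ ha; rewrite gE -(dE _ hx) /d /face_depth /= => e.
  move: ha hx; rewrite !inE /= => ha hx.
  have [ap bq cr] := @below_face_le _ _ _ a.+1 b.+1 c.+1 H erefl erefl erefl ha.
  have [xp yq zr] := @below_face_le _ _ _ x.+1 y.+1 z.+1 H erefl erefl erefl hx.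
  (* Points of equal depth differ by a solution with k = 0, so their coordinates are congruent,
     hence equal by size. *)
  have [dx dy dz] : [/\ (p %| a.+1%:Z - x.+1%:Z)%Z, (q %| b.+1%:Z - y.+1%:Z)%Z
                      & (r %| c.+1%:Z - z.+1%:Z)%Z].
    by apply: (@coprime_triple_dvd _ _ _ _ _ _ 0 H); lia.
  have ex := dvdz_small_eq _ _ _ dx erefl ap erefl xp.
  have ey := dvdz_small_eq _ _ _ dy erefl bq erefl yq.
  have ez := dvdz_small_eq _ _ _ dz erefl cr erefl zr.
  by congr (_, _, _); apply: val_inj => /=; lia.
apply/setP => n; rewrite inE; apply/idP/imsetP.
  move=> /(Delta_lt0 _ _ _ _ H)[a [b [c [a0 b0 c0 e]]]].
  have h : below_face p q r a b c by move: e; rewrite /face_depth /below_face; lia.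
  have [ap bq cr] := below_face_le _ _ _ _ _ _ H a0 b0 c0 h.
  have la : (`|a|.-1 < M)%N by lia.
  have lb : (`|b|.-1 < M)%N by lia.
  have lc : (`|c|.-1 < M)%N by lia.
  pose u : 'I_M * 'I_M * 'I_M := (Ordinal la, Ordinal lb, Ordinal lc).
  have ea : `|a|.-1.+1%:Z = a by lia.
  have eb : `|b|.-1.+1%:Z = b by lia.
  have ec : `|c|.-1.+1%:Z = c by lia.
  have uT : u \in tetrahedron M p q r by rewrite inE /= ea eb ec.
  exists u => //; apply: val_inj; apply/eqP; rewrite -eqz_nat -(dE u uT) /d /=.
  by rewrite ea eb ec e.
move=> [u /dE du ->]; apply/(Delta_lt0 _ _ _ _ H).
by exists u.1.1.+1%:Z, u.1.2.+1%:Z, u.2.+1%:Z.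
Qed.

Theorem proposition3p12 (p1 q1 r1 p2 q2 r2 : int)
  (h1 : coprime_triple p1 q1 r1) (h2 : coprime_triple p2 q2 r2)
  (hp : p1 >= p2) (hq : q1 >= q2) (hr : r1 >= r2) :
  kappa p1 q1 r1 >= kappa p2 q2 r2.
Proof.
have [a1 b1 c1 _] := h1; have [a2 b2 c2 _] := h2.
(* As r2 <= r1, the cube of side r1 holds both tetrahedra. *)
rewrite (@kappa_card `|r1|%N _ _ _ h1) ?(@kappa_card `|r1|%N _ _ _ h2); [|lia..].
rewrite lez_nat; apply/subset_leq_card/subsetP => u; rewrite !inE.
by apply: below_face_mono; lia.
Qed.
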